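(* Let $(\mathfrak g,\omega,J)$ be a pseudo-Kähler Lie algebra with abelian complex structure. Then there exists an APK-compatible pair $(U,H)$ such that $\mathfrak g$ and $\mathfrak g_U$ are holomorphically symplectomorphic.
   Context: All algebras are finite dimensional; Lie algebras $\mathfrak g$ here are real. An abelian complex structure on $\mathfrak g$ is a linear map $J:\mathfrak g\to\mathfrak g$ with $J^2=-\mathrm{id}$ and $[Jx,Jy]=[x,y]$ for all $x,y$. A symplectic form on $\mathfrak g$ is a non-degenerate skew-symmetric bilinear form $\omega$ with $\omega([x,y],z)+\omega([y,z],x)+\omega([z,x],y)=0$. A pseudo-Kähler Lie algebra with abelian complex structure is a triple $(\mathfrak g,\omega,J)$ with $J$ an abelian complex structure and $\omega$ a symplectic form with $\omega(Jx,Jy)=\omega(x,y)$. Two such triples are holomorphically symplectomorphic if there is an isomorphism of Lie algebras $\psi:\mathfrak g_1\to\mathfrak g_2$ with $\psi\circ J_1=J_2\circ\psi$ and $\omega_1(x,y)=\omega_2(\psi x,\psi y)$ for all $x,y$. Hermitian forms are $\mathbb C$-linear in the first argument, conjugate-linear in the second, and not assumed definite. Let $U$ be a complex associative commutative algebra (not necessarily unital) with a non-degenerate hermitian form $H$; let $R_z$ denote multiplication by $z$ in $U$ and $R_z^*$ its $H$-adjoint, $H(R_z^*x,y)=H(x,R_zy)$. The pair $(U,H)$ is APK-compatible if $xR_z^*y=yR_z^*x$ for all $x,y,z\in U$. For such a pair, $\mathfrak g_U$ denotes the underlying real vector space of $U$ with bracket $[x,y]=R_y^*x-R_x^*y$,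 complex structure $Jx=ix$ and symplectic form $\omega(x,y)=\mathrm{Im}\,H(x,y)$; it is a pseudo-Kähler Lie algebra with abelian complex structure. *)

(* Defs.v *)
From HB Require Import structures.
From mathcomp Require Import all_boot all_order all_algebra.
From mathcomp Require Import complex ring.
From mathcomp Require Import boolp classical_sets reals.

Set Implicit Arguments.
Unset Strict Implicit.
Unset Printing Implicit Defensive.

Import Order.TTheory GRing.Theory Num.Theory.
Import VectorInternalTheory.

Local Open Scope ring_scope.
Local Open Scope complex_scope.

Record lieAlgebra (R : realType) := LieAlgebra {
  lie_sort :> vectType R;
  lie_bracket : {bilinear lie_sort -> lie_sort -> lie_sort};
  lie_bracketxx : forall x, lie_bracket x x = 0;
  lie_jacobi : forall x y z,
    lie_bracket (lie_bracket x y) z + lie_bracket (lie_bracket y z) x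
      + lie_bracket (lie_bracket z x) y = 0 }.

Definition abelian_complex_structure (R : realType) (g : lieAlgebra R)
    (J : {linear g -> g}) : Prop :=
  (forall x, J (J x) = - x) /\
  (forall x y, lie_bracket g (J x) (J y) = lie_bracket g x y).

Definition symplectic_form (R : realType) (g : lieAlgebra R)
    (omega : {skew_symmetric g}) : Prop :=
  nondegenerate omega /\
  (forall x y z, omega (lie_bracket g x y) z + omega (lie_bracket g y z) x
                   + omega (lie_bracket g z x) y = 0).

Record pseudoKahler (R : realType) := PseudoKahler {
  pk_lie :> lieAlgebra R;
  pk_omega : {skew_symmetric pk_lie};
  pk_J : {linear pk_lie -> pk_lie};
  pk_abelian : abelian_complex_structure pk_J;
  pk_symplectic : symplectic_form pk_omega;
  pk_invariant : forall x y, pk_omega (pk_J x) (pk_J y) = pk_omega x y }.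

Definition holomorphically_symplectomorphic (R : realType)
    (g1 g2 : pseudoKahler R) : Prop :=
  exists psi : {linear g1 -> g2},
    [/\ bijective psi,
        forall x y, psi (lie_bracket g1 x y) = lie_bracket g2 (psi x) (psi y),
        forall x, psi (pk_J g1 x) = pk_J g2 (psi x)
      & forall x y, pk_omega g1 x y = pk_omega g2 (psi x) (psi y)].

(* Not necessarily unital, hence not one of the library's algebras. *)
Record comAssocAlgebra (R : realType) := ComAssocAlgebra {
  caa_sort :> vectType R[i];
  caa_mul : {bilinear caa_sort -> caa_sort -> caa_sort};
  caa_mulA : associative caa_mul;
  caa_mulC : commutative caa_mul }.

(* The value 0 is only taken when [f] has no adjoint at [x]: see [adjointP]. *)
Definition adjoint (R : realType) (U : vectType R[i])
    (H : {hermitian_sym U for (@conjc R)}) (f : U -> U) (x : U) : U :=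
  xget 0 [set w | forall y, H w y = H x (f y)]%classic.

(* R_z^*, with R_z the multiplication by z. *)
Definition mul_adjoint (R : realType) (U : comAssocAlgebra R)
    (H : {hermitian_sym U for (@conjc R)}) (z : U) : U -> U :=
  adjoint H (caa_mul U ^~ z).

Definition apk_compatible (R : realType) (U : comAssocAlgebra R)
    (H : {hermitian_sym U for (@conjc R)}) : Prop :=
  forall x y z : U, caa_mul U x (mul_adjoint H z y)
                  = caa_mul U y (mul_adjoint H z x).

Record apkPair (R : realType) := ApkPair {
  apk_alg :> comAssocAlgebra R;
  apk_form : {hermitian_sym apk_alg for (@conjc R)};
  apk_nondegenerate : nondegenerate apk_form;
  apk_compat : apk_compatible apk_form }.

Section NonDegenerate.
Variables (F : fieldType) (eps : bool) (theta : {rmorphism F -> F}).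
Variables (U : vectType F) (H : {hermitian U for eps & theta}).

Lemma nondegenerateP :
  reflect (forall x, (forall y, H x y = 0) -> x = 0) (nondegenerate H).
Proof.
apply: (iffP eqP) => [H0 x xP|H0].
  apply/eqP; rewrite -memv0 -H0; apply/mem_orthovP => y _; exact: xP.
apply/eqP; rewrite -subv0; apply/subvP => x /mem_orthovP xP.
by rewrite memv0; apply/eqP/H0 => y; apply: xP; rewrite memvf.
Qed.

Lemma riesz (phi : {linear U -> F | theta \; *%R}) :
  nondegenerate H -> exists w, forall y, H w y = phi y.
Proof.
move=> /nondegenerateP H0.
pose n := \dim {:U}.
pose e := vbasis {:U}.
pose ev (u : U) : 'rV[F]_n := \row_i H u e`_i.
have ev_lin : linear ev.
  by move=> a u v; apply/rowP => i; rewrite !mxE linearPl.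
pose E : {linear U -> 'rV[F]_n} :=
  HB.pack ev (GRing.isLinear.Build _ _ _ _ ev ev_lin).
have ext (w : U) (f : {linear U -> F | theta \; *%R}) :
    (forall i : 'I_n, H w e`_i = f e`_i) -> forall y, H w y = f y.
  move=> wf y; rewrite (coord_vbasis (memvf y)) !raddf_sum /=.
  by apply: eq_bigr => i _; rewrite linearZr_LR/= linearZ_LR/= wf.
have E0 : (lker (linfun E) == 0)%VS.
  rewrite -subv0; apply/subvP => u; rewrite memv_ker memv0 lfunE/= => /eqP/rowP u0.
  apply/eqP/H0 => y; rewrite (coord_vbasis (memvf y)) raddf_sum big1 //= => i _.
  by have := u0 i; rewrite !mxE linearZr_LR/= => ->; rewrite mulr0.
have Es : limg (linfun E) = fullv.
  apply/eqP; rewrite eqEdim subvf /=.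
  rewrite limg_dim_eq ?capfv; last exact/eqP.
  by rewrite dimvf /dim /= mul1n.
have /memv_imgP[w _ wE] : \row_i phi e`_i \in limg (linfun E).
  by rewrite Es memvf.
exists w; apply: ext => i.
by move/rowP: wE => /(_ i); rewrite lfunE/= !mxE.
Qed.
End NonDegenerate.

Section Adjoint.
Variables (R : realType) (U : vectType R[i]).
Variable H : {hermitian_sym U for (@conjc R)}.
Hypothesis H_nondeg : nondegenerate H.

Lemma adjointP (f : {linear U -> U}) x y : H (adjoint H f x) y = H x (f y).
Proof.
have phi_lin : linear_for (@conjc R \; *%R) (fun y => H x (f y)).
  by move=> a u v; rewrite linearP linearPr.
pose phi : {linear U -> R[i] | @conjc R \; *%R} :=
  HB.pack (fun y => H x (f y)) (GRing.isLinear.Build _ _ _ _ _ phi_lin).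
have [w wP] := riesz phi H_nondeg.
exact: (xgetPex 0 (ex_intro (fun w => forall y, H w y = H x (f y)) w wP)).
Qed.

Lemma hermitian_inj u v : (forall y, H u y = H v y) -> u = v.
Proof.
move=> uv; apply/eqP; rewrite -subr_eq0; apply/eqP.
by move/nondegenerateP: H_nondeg; apply=> y; rewrite linearBl/= uv subrr.
Qed.
End Adjoint.

(* The real vector space underlying a complex one. *)
Definition realify (R : realType) (U : Type) : Type := U.

Section Realify.
Variables (R : realType) (U : vectType R[i]).
Local Notation V := (realify R U).

HB.instance Definition _ := GRing.Zmodule.on V.

Definition realify_scale (a : R) (u : V) : V := a%:C *: (u : U).

Fact realify_scaleA a b u :
  realify_scale a (realify_scale b u) = realify_scale (a * b) u.
Proof. by rewrite /realify_scale scalerA rmorphM. Qed.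
Fact realify_scale1 : left_id 1 realify_scale.
Proof. by move=> u; rewrite /realify_scale rmorph1 scale1r. Qed.
Fact realify_scaleDr : right_distributive realify_scale +%R.
Proof. by move=> a u v; apply: scalerDr. Qed.
Fact realify_scaleDl u : {morph realify_scale^~ u : a b / a + b}.
Proof. by move=> a b; rewrite /realify_scale rmorphD scalerDl. Qed.

HB.instance Definition _ := GRing.Zmodule_isLmodule.Build R V
  realify_scaleA realify_scale1 realify_scaleDr realify_scaleDl.

Let n := dim U.
Let v2rR (u : V) : 'rV[R]_(n + n) :=
  row_mx (map_mx (@complex.Re R) (v2r (u : U))) (map_mx (@complex.Im R) (v2r (u : U))).

Fact realify_fin_dim : Vector.axiom (n + n) V.
Proof.
exists v2rR.
  move=> a u v; rewrite /v2rR scale_row_mx add_row_mx.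
  have -> : v2r (a *: u + v : V) = a%:C *: v2r (u : U) + v2r (v : U).
    exact: (linearP (v2r : {linear U -> _})).
  congr row_mx; apply/rowP => j; rewrite !mxE;
    case: (v2r _ _ _) (v2r _ _ _) => x y [z t] /=; by rewrite mul0r ?subr0 ?addr0.
exists (fun r => r2v (\row_i (lsubmx r 0 i +i* rsubmx r 0 i)) : V) => [u|r].
  rewrite /v2rR row_mxKl row_mxKr -[RHS]v2rK; congr r2v; apply/rowP => i.
  by rewrite !mxE; case: (v2r _ _ _).
rewrite /v2rR r2vK -[RHS]hsubmxK; congr row_mx; apply/rowP => i; by rewrite !mxE.
Qed.

HB.instance Definition _ := Lmodule_hasFinDim.Build R V realify_fin_dim.
End Realify.

Section ApkLie.
Variables (R : realType) (U : apkPair R).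
Local Notation V := (realify R U).
Local Notation "x ** y" := (caa_mul U x y) (at level 40).
Local Notation H := (apk_form U).
Local Notation adj := (mul_adjoint H).

Definition apk_bracket (x y : V) : V := adj y x - adj x y.
Definition apk_J (x : V) : V := 'i *: (x : U).
Definition apk_omega (x y : V) : R := complex.Im (H x y).

Lemma mul_adjointP z x y : H (adj z x) y = H x (y ** z).
Proof.
exact: (adjointP (apk_nondegenerate U) (applyr (caa_mul U) z)).
Qed.

Let H_inj := hermitian_inj (apk_nondegenerate U).

Let HC x y : H x y = conjc (H y x).
Proof. by rewrite hermC expr0 mul1r. Qed.

Lemma mul_adjointPr z x y : H x (adj z y) = H (x ** z) y.
Proof. by rewrite HC mul_adjointP -HC. Qed.

Lemma mul_adjoint_linear z a x y : adj z (a *: x + y) = a *: adj z x + adj z y.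
Proof. by apply: H_inj => t; rewrite linearPl/= !mul_adjointP linearPl. Qed.

Lemma mul_adjoint_conj z t a x : adj (a *: z + t) x = conjc a *: adj z x + adj t x.
Proof.
by apply: H_inj => u; rewrite linearPl/= !mul_adjointP linearPr linearPr.
Qed.

Lemma mul_adjoint_comm x y z : adj x (adj y z) = adj y (adj x z).
Proof.
apply: H_inj => t; rewrite !mul_adjointP -!caa_mulA.
by rewrite [x ** y]caa_mulC.
Qed.

Lemma mul_adjoint_adjoint x y z : adj (adj y x) z = y ** adj x z.
Proof.
apply: H_inj => t; rewrite mul_adjointP apk_compat.
by rewrite [x ** _]caa_mulC -mul_adjointP mul_adjointPr caa_mulC.
Qed.

Fact apk_bracket_bilinear : bilinear_for
  (GRing.Scale.Law.clone _ _ *:%R _) (GRing.Scale.Law.clone _ _ *:%R _)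
  apk_bracket.
Proof.
split=> [y|x] a u v; rewrite /apk_bracket /GRing.scale/= /realify_scale;
  rewrite mul_adjoint_linear mul_adjoint_conj conjc_real scalerBr opprD;
  by rewrite addrACA.
Qed.
HB.instance Definition _ :=
  bilinear_isBilinear.Build R V V V _ _ apk_bracket apk_bracket_bilinear.

Fact apk_bracketxx x : apk_bracket x x = 0.
Proof. exact: subrr. Qed.

Fact apk_jacobi x y z :
  apk_bracket (apk_bracket x y) z + apk_bracket (apk_bracket y z) x
    + apk_bracket (apk_bracket z x) y = 0.
Proof.
have E (a b c : U) : apk_bracket (apk_bracket a b) c =
    (adj c (adj b a) - adj c (adj a b)) - (b ** adj a c - a ** adj b c).
  rewrite /apk_bracket -!mul_adjoint_adjoint.
  have := mul_adjoint_linear c (-1) (adj a b) (adj b a).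
  have := mul_adjoint_conj (adj a b) (adj b a) (-1) c.
  rewrite rmorphN rmorph1 !scaleN1r.
  by rewrite ![- _ + _]addrC => -> ->.
have tele (a b c d e f : U) :
    a - b - (d - e) + (b - c - (e - f)) + (c - a - (f - d)) = 0.
  have sw (p q r s : U) : p - q - (r - s) = (p - r) - (q - s).
    by rewrite !opprD !opprK addrACA.
  by rewrite (sw a) (sw b) (sw c) subrKA subrKA subrr.
rewrite !E [adj x (adj z y)]mul_adjoint_comm [adj x (adj y z)]mul_adjoint_comm.
rewrite [caa_mul U x (adj y z)]apk_compat [caa_mul U z (adj x y)]apk_compat.
rewrite [caa_mul U x (adj z y)]apk_compat.
rewrite [adj z (adj y x)]mul_adjoint_comm; exact: tele.
Qed.

Fact apk_J_linear : linear apk_J.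
Proof.
move=> a u v.
have := scalerDr 'i%C (a%:C *: (u : U)) (v : U).
by rewrite scalerA mulrC -scalerA.
Qed.
HB.instance Definition _ := GRing.isLinear.Build R V V _ apk_J apk_J_linear.

Fact apk_omega_bilinear : bilinear_for
  (GRing.Scale.Law.clone _ _ *%R _) (GRing.Scale.Law.clone _ _ (idfun \; *%R) _)
  apk_omega.
Proof.
have Zre (a : R) (b : R[i]) : complex.Im (a%:C * b) = a * complex.Im b.
  by case: b => p q /=; rewrite mul0r addr0.
split=> [y|x] a u v; rewrite /apk_omega.
  have -> : H (a *: u + v) y = a%:C * H u y + H v y by exact: linearPl.
  by rewrite linearD /= Zre.
have -> : H x (a *: u + v) = a%:C * H x u + H x v.
  by rewrite -[in RHS]conjc_real; exact: linearPr.
by rewrite linearD /= Zre.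
Qed.
HB.instance Definition _ :=
  bilinear_isBilinear.Build R V V R _ _ apk_omega apk_omega_bilinear.
Fact apk_omega_skew x y : apk_omega x y = (-1) ^+ true * idfun (apk_omega y x).
Proof.
by rewrite /apk_omega HC; case: (H y x) => a b /=; rewrite mulN1r.
Qed.
HB.instance Definition _ :=
  isHermitianSesquilinear.Build R V true idfun apk_omega apk_omega_skew.

Definition apk_lie : lieAlgebra R := LieAlgebra apk_bracketxx apk_jacobi.

Let ii : 'i * 'i = -1 :> R[i].
Proof. by rewrite -expr2 sqr_i. Qed.

Fact apk_J_abelian : @abelian_complex_structure R apk_lie apk_J.
Proof.
split=> [x|x y].
  by have := scalerA 'i%C 'i%C (x : U); rewrite ii scaleN1r.
have adjJ (a b : U) : adj ('i%C *: a) ('i%C *: b) = adj a b.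
  apply: H_inj => t; rewrite !mul_adjointP linearZl_LR linearZr_LR linearZr_LR /=.
  by apply/eqP; rewrite eq_complex; case: (H _ _) => p q /=; apply/andP; split; apply/eqP; ring.
by rewrite /= /apk_bracket /apk_J !adjJ.
Qed.

Fact apk_omega_symplectic : @symplectic_form R apk_lie apk_omega.
Proof.
split.
  apply/nondegenerateP => x x0; apply: H_inj => y; rewrite linear0l.
  have := x0 ('i%C *: (y : U)); have := x0 y; rewrite /= /apk_omega.
  rewrite linearZr_LR /=; case: (H x y) => a b /= ->.
  by rewrite mul0r add0r mulN1r => /eqP; rewrite oppr_eq0 => /eqP ->.
move=> x y z; rewrite /= /apk_omega /apk_bracket.
have E (a b c : U) : complex.Im (H (adj b a - adj a b) c) =
    complex.Im (H a (c ** b)) - complex.Im (H b (c ** a)).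
  by rewrite linearBl /= !mul_adjointP raddfB.
rewrite !E [z ** y]caa_mulC [z ** x]caa_mulC [y ** x]caa_mulC.
by ring.
Qed.

Fact apk_omega_invariant x y : apk_omega (apk_J x) (apk_J y) = apk_omega x y.
Proof.
rewrite /apk_omega /apk_J linearZl_LR linearZr_LR /=.
by case: (H _ _) => p q /=; ring.
Qed.

(* g_U. *)
Definition apk_pseudoKahler : pseudoKahler R :=
  @PseudoKahler R apk_lie apk_omega apk_J
    apk_J_abelian apk_omega_symplectic apk_omega_invariant.
End ApkLie.

(* Main.v *)
Require Import Defs.
From mathcomp Require Import all_boot all_order all_algebra reals.
From HB Require Import structures.
From mathcomp Require Import complex ring lra.

(* Closedness of omega, resp. the Jacobi identity, evaluated at (x, y, z) and at
   (x, Jy, Jz), splits into components according to which arguments are complex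
   linear and which are antilinear.  Writing [x, y] = A x y - A y x, with A
   complex linear in the first and antilinear in the second argument, this gives
     H (A x y) z = H (A x z) y,
     A (A x y) z = A (A x z) y,   A y (A x z) = A z (A x y),
   where H x y = omega (J x) y + i omega x y.  The algebra U is g with R_y the
   H-adjoint of A ^~ y; the three identities make it, in this order,
   commutative, associative and (with the first again) APK-compatible. *)

Set Implicit Arguments.
Unset Strict Implicit.
Unset Printing Implicit Defensive.

Import GRing.Theory Num.Theory.
Import VectorInternalTheory.

Local Open Scope ring_scope.
Local Open Scope complex_scope.

(* [V] as a complex vector space, ['i] acting by [J]. *)
Definition complexify (R : realType) (V : vectType R) (J : {linear V -> V})
    (JJ : forall x, J (J x) = - x) : Type := V.

(** * Complex scaling and finite dimension *)

Section Complexify.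
Variables (R : realType) (V : vectType R) (J : {linear V -> V}).
Hypothesis JJ : forall x, J (J x) = - x.
Local Notation U := (complexify JJ).

HB.instance Definition _ := GRing.Zmodule.on U.

Definition complexify_scale (c : R[i]) (u : U) : U :=
  complex.Re c *: (u : V) + complex.Im c *: J u.

Fact complexify_scaleA a b u :
  complexify_scale a (complexify_scale b u) = complexify_scale (a * b) u.
Proof.
case: a b => [a a'] [b b']; rewrite /complexify_scale /=.
rewrite (linearD J) !(linearZ_LR J) /= JJ.
rewrite !scalerDr !scalerN !scalerA !scalerDl scaleNr.
by rewrite [X in _ + X = _]addrC addrACA.
Qed.

Fact complexify_scale1 : left_id 1 complexify_scale.
Proof. by move=> u; rewrite /complexify_scale scale1r scale0r addr0. Qed.

Fact complexify_scaleDr : right_distributive complexify_scale +%R.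
Proof.
by move=> a u v; rewrite /complexify_scale (linearD J) !scalerDr addrACA.
Qed.

Fact complexify_scaleDl u : {morph complexify_scale^~ u : a b / a + b}.
Proof.
by move=> [a a'] [b b']; rewrite /complexify_scale /= !scalerDl addrACA.
Qed.

HB.instance Definition _ := GRing.Zmodule_isLmodule.Build R[i] U
  complexify_scaleA complexify_scale1 complexify_scaleDr complexify_scaleDl.

Lemma complexify_scaleE (c : R[i]) (u : U) :
  c *: u = complex.Re c *: (u : V) + complex.Im c *: J u :> V.
Proof. by []. Qed.

Let n := dim V.
Let toC (x : V) : 'rV[R[i]]_n := map_mx (real_complex R) (v2r x).
Let ofR : 'rV[R]_n -> V := r2v.
Let Jr : {linear 'rV[R]_n -> 'rV[R]_n} :=
  GRing.Linear.clone _ _ _ _ (v2r \o J \o r2v) _.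
Let JC : 'M[R[i]]_n := map_mx (real_complex R) (lin1_mx Jr).

Let toC_J x : toC x *m JC = toC (J x).
Proof. by rewrite -map_mxM (mul_rV_lin1 Jr) /= v2rK. Qed.

Let toCN x : toC (- x) = - toC x.
Proof. by rewrite /toC (linearN (v2r : {linear V -> _})) map_mxN. Qed.

(* [V] is isomorphic to the ['i]-eigenspace of [J] on [V] tensored with the
   complex numbers, by [x |-> x - 'i J x]. *)
Let E : {vspace 'rV[R[i]]_n} := lker (linfun (mulmxr (JC - 'i%:M))).

Let holo (x : U) : 'rV[R[i]]_n := toC x - 'i *: toC (J x).

Let holo_in x : holo x \in E.
Proof.
rewrite memv_ker lfunE /= mulmxBr mul_mx_scalar mulmxBl -scalemxAl !toC_J JJ.
rewrite /holo scalerBr scalerA -expr2 sqr_i scaleN1r.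
by rewrite toCN scalerN !opprK [X in _ - X]addrC subrr.
Qed.

(** Coordinates of [holo u] in the eigenspace [E] serve as complex coordinates of [u], so no basis
    adapted to [J] has to be constructed. *)
Fact complexify_fin_dim : Vector.axiom (\dim E) U.
Proof.
have toCD (x y : V) : toC (x + y) = toC x + toC y.
  by rewrite /toC (linearD (v2r : {linear V -> _})) map_mxD.
have toCZ a (x : V) : toC (a *: x) = a%:C *: toC x.
  by rewrite /toC (linearZ_LR (v2r : {linear V -> _})) map_mxZ.
have holo_lin : linear holo.
  move=> [a b] u v; rewrite /holo complexify_scaleE /=.
  rewrite !(linearD J) !(linearZ_LR J) /= JJ !toCD !toCZ toCN.
  move: (toC u) (toC v) (toC _) (toC _) => p q p' q'.
  apply/rowP => j; rewrite !mxE.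
  case: (p 0 j) (p' 0 j) (q 0 j) (q' 0 j) => [x1 x2] [x3 x4] [x5 x6] [x7 x8].
  by apply/eqP; rewrite eq_complex /=; apply/andP; split; apply/eqP; ring.
exists (fun u => v2r (vsproj E (holo u))).
  by move=> c u v; rewrite holo_lin !linearP.
(* The real part of [holo u] gives back [u]. *)
exists (fun r => ofR (map_mx (@complex.Re R) (vsval (r2v r : subvs_of E)))).
  move=> u; rewrite v2rK vsprojK ?holo_in //.
  rewrite -[RHS]v2rK; congr r2v; apply/rowP => j.
  by rewrite !mxE /=; ring.
move=> r; rewrite -[RHS]r2vK; congr v2r; apply: val_inj => /=.
rewrite vsprojK ?holo_in //.
have := subvsP (r2v r : subvs_of E); set w := vsval _.
rewrite memv_ker lfunE /= mulmxBr mul_mx_scalar subr_eq0 => /eqP wJ.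
have re (m k : nat) (A : 'M[R[i]]_(m, k)) (B : 'M[R]_(k, k)) :
    map_mx (@complex.Re R) (A *m map_mx (real_complex R) B)
    = map_mx (@complex.Re R) A *m B.
  apply/matrixP => i j; rewrite !mxE raddf_sum /=; apply: eq_bigr => l _.
  by rewrite !mxE; case: (A _ _) => p q /=; ring.
(* Real parts in [w *m JC = 'i *: w]: [J] sends Re w to - Im w, so [w] is [holo] of its real
   part. *)
have wJr :
    v2r (J (ofR (map_mx (@complex.Re R) w))) = - map_mx (@complex.Im R) w.
  move/(congr1 (map_mx (@complex.Re R))): wJ; rewrite re mul_rV_lin1 /= => ->.
  by apply/rowP => j; rewrite !mxE; case: (w _ _) => p q /=; ring.
apply/rowP => j; rewrite /holo /toC wJr r2vK !mxE.
case: (w _ _) => p q; apply/eqP; rewrite eq_complex /=.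
by apply/andP; split; apply/eqP; ring.
Qed.

HB.instance Definition _ := Lmodule_hasFinDim.Build R[i] U complexify_fin_dim.
End Complexify.

(** * The sesquilinear part of the bracket *)

Section PseudoKahlerAlgebra.
Variables (R : realType) (g : pseudoKahler R).
Local Notation J := (pk_J g).
Local Notation omega := (pk_omega g).
Local Notation "[[ x , y ]]" := (lie_bracket g x y).

Let JJ x : J (J x) = - x := (pk_abelian g).1 x.
Let JJb x y : [[J x, J y]] = [[x, y]] := (pk_abelian g).2 x y.

Let omega_inj (x y : g) : (forall w, omega x w = omega y w) -> x = y.
Proof.
move=> xy; apply/eqP; rewrite -subr_eq0; apply/eqP.
have /nondegenerateP := (pk_symplectic g).1; apply=> w.
by rewrite linearBl /= xy subrr.
Qed.

Let omegaC x y : omega y x = - omega x y.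
Proof. by rewrite hermC expr1 mulN1r. Qed.

Let omegaJ x y : omega x (J y) = - omega (J x) y.
Proof. by rewrite -pk_invariant JJ linearNr. Qed.

Let bracketC x y : [[y, x]] = - [[x, y]].
Proof.
apply/eqP; rewrite -addr_eq0; apply/eqP.
have := lie_bracketxx (x + y).
by rewrite linearDl !linearDr /= !lie_bracketxx add0r addr0 addrC.
Qed.

Let bracketJ x y : [[x, J y]] = - [[J x, y]].
Proof. by rewrite -(JJb x) JJ linearNr. Qed.

(* The part of the bracket that is complex linear in [x], antilinear in [y]. *)
Definition bracket_part (x y : g) : g := 2^-1 *: ([[x, y]] - J [[J x, y]]).
Local Notation A := bracket_part.

Lemma bracket_partDl x x' y : A (x + x') y = A x y + A x' y.
Proof.
rewrite /A (linearD J) !(linearDl (lie_bracket g)) (linearD J).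
by rewrite opprD addrACA scalerDr.
Qed.

Lemma bracket_partDr x y y' : A x (y + y') = A x y + A x y'.
Proof.
by rewrite /A !(linearDr (lie_bracket g)) (linearD J) opprD addrACA scalerDr.
Qed.

Lemma bracket_partZl a x y : A (a *: x) y = a *: A x y.
Proof.
rewrite /A (linearZ_LR J) !(linearZl_LR (lie_bracket g)) (linearZ_LR J) /=.
by rewrite -scalerBr !scalerA mulrC.
Qed.

Lemma bracket_partZr a x y : A x (a *: y) = a *: A x y.
Proof.
rewrite /A !(linearZr_LR (lie_bracket g)) (linearZ_LR J) /=.
by rewrite -scalerBr !scalerA mulrC.
Qed.

Lemma bracket_partJl x y : A (J x) y = J (A x y).
Proof.
rewrite /A JJ (linearNl (lie_bracket g)) (linearN J) opprK (linearZ_LR J).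
by rewrite (linearB J) JJ opprK addrC.
Qed.

Lemma bracket_partJr x y : A x (J y) = - J (A x y).
Proof.
rewrite -bracket_partJl /A !bracketJ !JJ (linearN J) (linearNl (lie_bracket g)).
by rewrite (linearN J) !opprK -scalerN opprD.
Qed.

Lemma bracket_partNl x y : A (- x) y = - A x y.
Proof. by rewrite -scaleN1r bracket_partZl scaleN1r. Qed.

Lemma bracket_partNr x y : A x (- y) = - A x y.
Proof. by rewrite -scaleN1r bracket_partZr scaleN1r. Qed.

(** Since [J] is abelian, the rest of the bracket, half of [x, y] + J [J x, y], is antilinear in x
    and linear in y; skew symmetry identifies it with - A y x. *)
Lemma bracketE x y : [[x, y]] = A x y - A y x.
Proof.
rewrite /A [ [[y, x]] ]bracketC [ [[J y, x]] ]bracketC bracketJ opprK.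
rewrite -scalerBr -opprD opprK addrACA addNr addr0 -mulr2n.
by rewrite -scaler_nat scalerA mulVf ?scale1r // pnatr_eq0.
Qed.

(** * Closedness and the Jacobi identity in terms of [A] *)

(** Of the six terms of closedness, passing from (x, y, z) to (x, Jy, Jz) changes the sign of
    exactly these two. *)
Lemma omega_bracket_partC x y z : omega (A x y) z = omega (A x z) y.
Proof.
have closed := (pk_symplectic g).2.
have := closed x (J y) (J z); have := closed x y z.
rewrite !bracketE !(bracket_partJl, bracket_partJr) !(linearBl omega) /=.
rewrite !(pk_invariant, linearNl omega, linearN J, opprK) /=.
rewrite !omegaJ !JJ !(linearNl omega) /=.
lra.
Qed.

(** The same passage changes the sign of exactly the four Jacobi terms that contain A x y or A x
    z. *)
Let jacobi_part x y z :
  A (A x y) z - A (A x z) y = A z (A x y) - A y (A x z).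
Proof.
(* Pairing with [w] makes the identity scalar, within reach of [lra]. *)
apply: omega_inj => w.
have := congr1 (omega ^~ w) (lie_jacobi x (J y) (J z)).
have := congr1 (omega ^~ w) (lie_jacobi x y z).
rewrite !bracketE !(bracket_partDl, bracket_partDr, bracket_partNl,
  bracket_partNr, bracket_partJl, bracket_partJr).
rewrite !(linearN J, opprK, JJ).
rewrite !(linearDl omega, linearNl omega) /= (linear0l omega).
lra.
Qed.

(** In [jacobi_part] the left side is linear in x and the right side antilinear, so both vanish. *)
Lemma bracket_partCl x y z : A (A x y) z = A (A x z) y.
Proof.
apply: omega_inj => w.
have := congr1 (omega ^~ w) (jacobi_part x y z).
have := congr1 (omega ^~ (J w)) (jacobi_part (J x) y z).
rewrite !(bracket_partJl, bracket_partJr).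
rewrite !(linearDl omega, linearNl omega) /= !pk_invariant.
lra.
Qed.

Lemma bracket_partCr x y z : A y (A x z) = A z (A x y).
Proof.
apply/eqP; rewrite eq_sym -subr_eq0 -jacobi_part; apply/eqP.
by rewrite bracket_partCl subrr.
Qed.

(** * The hermitian form *)

Local Notation U := (complexify JJ).

Lemma bracket_partPl (c : R[i]) (x x' y : U) :
  A (c *: x + x') y = c *: (A x y : U) + (A x' y : U) :> U.
Proof.
rewrite !complexify_scaleE [LHS]bracket_partDl bracket_partDl !bracket_partZl.
by rewrite bracket_partJl.
Qed.

(** Linearity in x and imaginary part [omega] force the real part, as Re H x y = Im H (J x) y. *)
Definition pk_herm (x y : U) : R[i] := omega (J x) y +i* omega x y.
Local Notation H := pk_herm.

Fact pk_herm_bilinear : bilinear_for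
  (GRing.Scale.Law.clone _ _ *%R _)
  (GRing.Scale.Law.clone _ _ (@conjc R \; *%R) _) H.
Proof.
split=> [y|x] [a b] u v; apply/eqP; rewrite eq_complex /= complexify_scaleE /=.
  rewrite !(linearD J) !(linearZ_LR J) /= JJ.
  rewrite !(linearDl omega) !(linearZl_LR omega) (linearNl omega) /=.
  by apply/andP; split; apply/eqP; ring.
rewrite !(linearDr omega) !(linearZr_LR omega) /= !omegaJ JJ (linearNl omega).
by apply/andP; split; apply/eqP; ring.
Qed.
HB.instance Definition _ :=
  bilinear_isBilinear.Build R[i] U U R[i] _ _ pk_herm pk_herm_bilinear.

Fact pk_herm_sym x y : H x y = (-1) ^+ false * conjc (H y x).
Proof. by rewrite mul1r /pk_herm /= omegaC omegaJ opprK -omegaC. Qed.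
HB.instance Definition _ :=
  isHermitianSesquilinear.Build R[i] U false (@conjc R) pk_herm pk_herm_sym.

Definition pk_hermitian : {hermitian_sym U for (@conjc R)} := pk_herm.

Lemma pk_herm_nondegenerate : nondegenerate pk_hermitian.
Proof.
apply/nondegenerateP => x x0; apply: omega_inj => y.
by rewrite linear0l; have [] := x0 y.
Qed.

Lemma pk_herm_bracket_partC (x y z : U) : H (A x y) z = H (A x z) y.
Proof.
by rewrite /pk_herm -!bracket_partJl !(omega_bracket_partC _ y).
Qed.

Fact bracket_part_linear (y : U) : linear (fun x : U => A x y : U).
Proof. by move=> c x x'; rewrite bracket_partPl. Qed.

(** * The commutative associative algebra *)

Definition pk_mul (x y : U) : U :=
  adjoint pk_hermitian (fun t : U => A t y : U) x.
Local Notation "x ** y" := (pk_mul x y) (at level 40).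

Lemma pk_mulE (x y t : U) : H (x ** y) t = H x (A t y).
Proof.
pose f : {linear U -> U} :=
  HB.pack (fun t : U => A t y : U)
    (GRing.isLinear.Build _ _ _ _ _ (bracket_part_linear y)).
exact: (adjointP pk_herm_nondegenerate f).
Qed.

Let herm_inj := hermitian_inj pk_herm_nondegenerate.

Let hermC x y : H x y = conjc (H y x).
Proof. by rewrite {1}pk_herm_sym mul1r. Qed.

Fact pk_mulC : commutative pk_mul.
Proof.
move=> x y; apply: herm_inj => t /=.
by rewrite !pk_mulE hermC pk_herm_bracket_partC -hermC.
Qed.

Fact pk_mulA : associative pk_mul.
Proof.
move=> x y z; apply: herm_inj => t /=.
(* Commutativity reduces the claim to R_x and R_z commuting on y; their adjoints commute by
   [bracket_partCl]. *)
by rewrite (pk_mulC x) (pk_mulC x y) !pk_mulE bracket_partCl.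
Qed.

Fact pk_mul_bilinear : bilinear_for
  (GRing.Scale.Law.clone _ _ *:%R _) (GRing.Scale.Law.clone _ _ *:%R _) pk_mul.
Proof.
have lin y : linear (pk_mul ^~ y).
  move=> c u v; apply: herm_inj => t /=.
  by rewrite pk_mulE !(linearPl pk_hermitian) /= -!pk_mulE.
split=> [y|x]; first exact: lin.
by move=> c u v; rewrite /= !(pk_mulC x) lin.
Qed.
HB.instance Definition _ :=
  bilinear_isBilinear.Build R[i] U U U _ _ pk_mul pk_mul_bilinear.

Definition pk_alg : comAssocAlgebra R := ComAssocAlgebra pk_mulA pk_mulC.

(** The double adjoint is the original map; with [bracketE] this recovers the bracket of [g] from
    the algebra. *)
Lemma pk_mul_adjointE (x y : U) :
  @mul_adjoint R pk_alg pk_hermitian y x = A x y.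
Proof.
apply: herm_inj => t.
rewrite (adjointP pk_herm_nondegenerate (applyr (caa_mul pk_alg) y)) /=.
by rewrite /applyr /= hermC pk_mulE -hermC.
Qed.

Fact pk_compatible : @apk_compatible R pk_alg pk_hermitian.
Proof.
move=> x y z; rewrite !pk_mul_adjointE; apply: herm_inj => t.
rewrite /= (pk_mulC x) (pk_mulC y) !pk_mulE.
(* Exchanging z with A t x produces A y (A t x), where x and y can be swapped; the last exchange
   brings z back. *)
by rewrite pk_herm_bracket_partC bracket_partCr pk_herm_bracket_partC.
Qed.

Definition pk_apk : apkPair R := @ApkPair R pk_alg pk_hermitian
  pk_herm_nondegenerate pk_compatible.

End PseudoKahlerAlgebra.

Theorem theorem3p7 (R : realType) (g : pseudoKahler R) :
  exists U : apkPair R,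
    holomorphically_symplectomorphic g (apk_pseudoKahler U).
Proof.
exists (pk_apk g).
(* [complexify] and [realify] keep the carrier, so the identity is the required map; its linearity
   says that the two real scalings agree. *)
have id_lin : linear (fun x : g => x : apk_pseudoKahler (pk_apk g)).
  move=> a x y.
  rewrite /GRing.scale /= /realify_scale /= complexify_scaleE /=.
  by rewrite scale0r addr0.
pose psi : {linear g -> apk_pseudoKahler (pk_apk g)} :=
  HB.pack (fun x : g => x : apk_pseudoKahler (pk_apk g))
    (GRing.isLinear.Build _ _ _ _ _ id_lin).
exists psi; split.
- by exists id.
- by move=> x y; rewrite bracketE /= /apk_bracket !pk_mul_adjointE.
- move=> x; rewrite /= /apk_J complexify_scaleE /=.
  by rewrite scale0r scale1r add0r.
- by [].
Qed.
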